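(* Let $q$ be an odd prime power and let $\gamma,\delta\in\mathbb{F}_{q^2}$ with $\gamma\neq 0$. Then the polynomial $$f(x)=(x^q-x+\delta)^{q+2}+(x^q-x+\delta)^{2q+1}+\gamma x$$ is a permutation polynomial of $\mathbb{F}_{q^2}$ if and only if either $\gamma\in\mathbb{F}_q^*$, or $\gamma\in\mathbb{F}_{q^2}^*\setminus\mathbb{F}_q$ and $\mathrm{Tr}_q^{q^2}(\delta)=0$.
   Context: A polynomial over a finite field $\mathbb{F}$ is a permutation polynomial of $\mathbb{F}$ if the map it induces on $\mathbb{F}$ is a bijection. For $x\in\mathbb{F}_{q^2}$, $\mathrm{Tr}_q^{q^2}(x)=x+x^q$. *)

(* Defs.v *)
From HB Require Import structures.
From mathcomp Require Import all_boot all_order all_algebra all_field.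

Set Implicit Arguments.
Unset Strict Implicit.
Unset Printing Implicit Defensive.

Import GRing.Theory.
Local Open Scope ring_scope.

Definition odd_prime_power (q : nat) : Prop :=
  exists p k : nat, [/\ prime p, odd p, (0 < k)%N & q = (p ^ k)%N].

(* Typed over an arbitrary field because a fieldExtType over a finite field
   carries no canonical finType structure. *)
Definition permutation_polynomial (L : fieldType) (f : {poly L}) : Prop :=
  bijective (fun x : L => f.[x]).

(* The trace from the field with q ^ 2 elements to the field with q elements. *)
Definition trace_q (L : fieldType) (q : nat) (x : L) : L := x + x ^+ q.

Definition f_poly (L : fieldType) (q : nat) (gamma delta : L) : {poly L} :=
  ('X^q - 'X + delta%:P) ^+ (q + 2) + ('X^q - 'X + delta%:P) ^+ (2 * q + 1)
  + gamma *: 'X.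

(* Main.v *)
(* Write y = x^q - x + delta, so that y + y^q = T := Tr(delta) for every x and
   f(x) = T * N(y) + gamma * x, where N(y) = y^(q+1) lies in F_q.  If T = 0
   then f is the linear map gamma * x.  If gamma lies in F_q, then f(x) = f(z)
   forces x - z into F_q, so that x and z give the same y, and x = z.  If
   T != 0 and gamma is outside F_q, put u = gamma^-q - gamma^-1, which is
   nonzero; since N(y + u) - N(y) = u * (y^q - y - u), the points z and
   z + gamma^-1 collide as soon as T * u * (y^q - y - u) = -1, and this only
   prescribes z^q - z to be a certain element of trace zero. *)
Require Import Defs.
From HB Require Import structures.
From mathcomp Require Import all_boot all_order all_algebra all_field.
From mathcomp Require Import ring.

Set Implicit Arguments.
Unset Strict Implicit.
Unset Printing Implicit Defensive.

Import GRing.Theory.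
Local Open Scope ring_scope.

Section QuadraticFrobenius.

Variables (L : fieldType) (q : nat).
Hypothesis pchar_q : [pchar L].-nat q.
Hypothesis frobK : forall x : L, (x ^+ q) ^+ q = x.

Lemma frobD (x y : L) : (x + y) ^+ q = x ^+ q + y ^+ q.
Proof. exact: exprDn_pchar. Qed.

Lemma frobN (x : L) : (- x) ^+ q = - x ^+ q.
Proof. exact: exprNn_pchar. Qed.

Lemma frob_natr n : (n%:R : L) ^+ q = n%:R.
Proof.
elim: n => [|n IHn]; last by rewrite -natr1 frobD IHn expr1n.
by case/andP: pchar_q => q_gt0 _; rewrite expr0n gtn_eqF.
Qed.

Lemma f_polyE (gamma delta x : L) :
  (f_poly q gamma delta).[x] =
  trace_q q delta * (x ^+ q - x + delta) ^+ q.+1 + gamma * x.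
Proof.
rewrite /f_poly /trace_q !hornerE !exprD.
set y := x ^+ q - x + delta.
have yq : y ^+ q = - y + (delta + delta ^+ q).
  by rewrite /y !frobD frobN frobK; ring.
by rewrite (exprS _ q) yq; ring.
Qed.

Lemma f_poly_inj (gamma delta : L) : gamma != 0 -> gamma ^+ q = gamma ->
  injective (fun x => (f_poly q gamma delta).[x]).
Proof.
move=> gamma0 gammaq x z; rewrite !f_polyE.
set T := trace_q q delta; set y := x ^+ q - x + delta.
set y' := z ^+ q - z + delta => fxz.
have Tq : T ^+ q = T by rewrite frobD frobK addrC.
have normq (t : L) : (t ^+ q.+1) ^+ q = t ^+ q.+1.
  by rewrite exprS exprMn frobK mulrC.
(* The trace [T], both norms and [gamma] are fixed by Frobenius, hence so is this quotient. *)
have dE : x - z = T * (y' ^+ q.+1 - y ^+ q.+1) / gamma.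
  apply: (mulfI gamma0); rewrite [RHS]mulrC divfK //.
  by apply/eqP; rewrite mulrBr mulrBr subr_eq addrAC eq_sym subr_eq -fxz addrC.
have dq : (x - z) ^+ q = x - z.
  by rewrite dE !exprMn exprVn gammaq Tq frobD frobN !normq.
have yy' : y = y'.
  apply/eqP; rewrite -subr_eq0; apply/eqP.
  suff -> : y - y' = (x - z) ^+ q - (x - z) by rewrite dq subrr.
  by rewrite /y /y' frobD frobN; ring.
by apply/eqP; rewrite -subr_eq0 dE yy' subrr mulr0 mul0r.
Qed.

Lemma f_poly_collision (gamma delta : L) : 2 != 0 :> L ->
    gamma ^+ q != gamma -> trace_q q delta != 0 ->
  ~ injective (fun x => (f_poly q gamma delta).[x]).
Proof.
move=> nz2 gammaq T0 f_inj.
have gamma0 : gamma != 0.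
  by apply: contraNneq gammaq => ->; rewrite (frob_natr 0).
pose T := trace_q q delta.
have Tq : T ^+ q = T by rewrite /T /trace_q frobD frobK addrC.
pose d := gamma^-1; pose u := d ^+ q - d.
have u0 : u != 0.
  rewrite subr_eq0 /d exprVn; apply: contra gammaq.
  by move=> /eqP/invr_inj ->.
have uq : u ^+ q = - u by rewrite /u frobD frobN frobK opprB.
(* Solves [T * u * (y ^+ q - y - u) = -1] for [y = w + delta], given that [w ^+ q = - w] turns
   [y ^+ q - y] into [delta ^+ q - delta - 2 * w]. *)
pose w := (delta ^+ q - delta - u + (T * u)^-1) / 2.
have wq : w ^+ q = - w.
  rewrite /w exprMn exprVn (frob_natr 2) !frobD !frobN frobK exprVn exprMn.
  by rewrite Tq uq; field; rewrite oppr_eq0 nz2 u0 T0.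
(* On elements negated by Frobenius, [t ^+ q - t] is [-2 * t]; dividing by -2 inverts it. *)
pose z := - w / 2.
have zw : z ^+ q - z = w.
  by rewrite /z exprMn exprVn (frob_natr 2) frobN wq; field.
have : z + d = z.
  apply: f_inj; rewrite !f_polyE -/T frobD.
  have -> : z ^+ q + d ^+ q - (z + d) + delta = (z ^+ q - z) + u + delta.
    by rewrite /u; ring.
  rewrite zw !exprS (frobD (w + u)) !(frobD w) wq uq (mulrDr gamma) /d mulfV // /w.
  by field; rewrite nz2 T0 u0.
by move/eqP; rewrite -subr_eq0 addrAC subrr add0r invr_eq0 (negPf gamma0).
Qed.

End QuadraticFrobenius.

(* L is the field with q ^ 2 elements, presented as a quadratic extension of
   the field Fq with q elements; 1%VS is the copy of Fq inside L. *)
Theorem theorem3p4 (q : nat) (Fq : finFieldType) (L : fieldExtType Fq)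
    (gamma delta : L) :
  odd_prime_power q -> #|Fq| = q -> \dim {:L} = 2%N -> gamma != 0 ->
  permutation_polynomial (f_poly q gamma delta) <->
  (gamma \in 1%VS /\ gamma != 0) \/
  (gamma != 0 /\ gamma \notin 1%VS /\ trace_q q delta = 0).
Proof.
move=> [p [k [p_pr p_odd k_gt0 q_pk]]] cardF dimL gamma0.
have pL : p \in [pchar L].
  by rewrite pchar_lalg; apply: (@card_finPcharP _ p k) => //; rewrite cardF.
have pchar_q : [pchar L].-nat q.
  by rewrite q_pk pnatX (eq_pnat _ (pcharf_eq pL)) pnat_id.
have frobK (x : L) : (x ^+ q) ^+ q = x.
  have := Fermat's_little_theorem {:L}%AS x.
  by rewrite memvf cardF dimL -exprM => /esym/eqP.
have mem1 (x : L) : (x \in 1%VS) = (x ^+ q == x).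
  by rewrite (Fermat's_little_theorem 1%AS x) dimv1 cardF expn1.
have nz2 : 2 != 0 :> L.
  rewrite -(dvdn_pcharf pL) dvdn_prime2 //.
  by apply: contraTneq p_odd => ->.
(* [L] is finite-dimensional over the finite field [Fq], so [finvect_type] makes it a finite type,
   where injectivity suffices. *)
have bijP (g : L -> L) : injective g -> bijective g.
  by move=> g_inj; exact: (@injF_bij (finvect_type L) g g_inj).
split=> [/bij_inj f_inj|].
  have [gammaF|gammaF] := boolP (gamma \in 1%VS); first by left.
  right; split=> //; split=> //; apply/eqP/negP => /negP T0.
  by apply: (f_poly_collision pchar_q frobK nz2 _ T0 f_inj); rewrite -mem1.
case=> [[gammaF _]|[_ [_ T0]]]; apply: bijP.
  by apply: (f_poly_inj pchar_q frobK gamma0); apply/eqP; rewrite -mem1.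
move=> x z; rewrite !(f_polyE pchar_q frobK) T0 !mul0r !add0r.
exact: mulfI.
Qed.
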